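(* Let $G$ be a finite abelian group with identity element $e$. Let $(M,\varepsilon)$ be a $G$-span from $S\xrightarrow{H}BG$ to $T\xrightarrow{V}BG$. Let $(\mathrm{id}_S,e)_*$ be the $G$-span from $S\xrightarrow{H}BG$ to $S\xrightarrow{H}BG$ with apex $S$, both functors $L,R$ equal to $\mathrm{id}_S$, and natural transformation $H\Rightarrow H$ the constant function $\mathrm{Ob}(S)\to G$ with value $e$; let $(\mathrm{id}_T,e)_*$ be the analogous $G$-span from $T\xrightarrow{V}BG$ to $T\xrightarrow{V}BG$ with apex $T$. Then the associated matrices over $\mathbf{Q}G$ satisfy $$[(\mathrm{id}_S,e)_*]\,[M,\varepsilon]=[M,\varepsilon]=[M,\varepsilon]\,[(\mathrm{id}_T,e)_*].$$
   Context: $\mathbf{Q}G$ is the rational group ring of $G$, and $BG$ is the groupoid with a single object $\bullet$ and automorphism group $G$. A finite groupoid has finitely many objects and morphisms. For a groupoid $S$, $S(a,b)$ is the set of morphisms from $a$ to $b$, and $\pi_0(S)$ is the set of isomorphism classes of objects; a representative object is fixed in each class and the same letter denotes a class and its representative (the same choice is used in all matrices occurring). The Euler characteristic of a finite groupoid is $\chi(S)=\sum_{c\in\pi_0(S)}|S(c,c)|^{-1}$. For an object $d$ of $T$, $T\{d\}$ is the full subgroupoid of $T$ on the object $d$, so $\chi(T\{d\})=|T(d,d)|^{-1}$. For a function $\varepsilon\colon\mathrm{Ob}(T)\to Y$ and $y\in Y$, $T\{\varepsilon=y\}$ is the full subgroupoid of $T$ on the objects in $\varepsilon^{-1}(y)$.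 $G$-span: a $G$-span $(M,\varepsilon)$ from $S\xrightarrow{H}BG$ to $T\xrightarrow{V}BG$ with apex $M$ consists of finite groupoids $S,T,M$, functors $H\colon S\to BG$, $V\colon T\to BG$, $L\colon M\to S$, $R\colon M\to T$, and a function $\varepsilon\colon\mathrm{Ob}(M)\to G$ that is a natural transformation $HL\Rightarrow VR$, i.e. $\varepsilon(a_2)\,(HL)(m)=(VR)(m)\,\varepsilon(a_1)$ in $G$ for all $m\in M(a_1,a_2)$. Two-sided homotopy fibre: for $c\in\mathrm{Ob}(S)$, $d\in\mathrm{Ob}(T)$, the groupoid $c\backslash M/d$ has as objects all triples $(s,a,t)$ with $a\in\mathrm{Ob}(M)$, $s\in S(c,La)$, $t\in T(Ra,d)$; a morphism $(s_1,a_1,t_1)\to(s_2,a_2,t_2)$ is an $m\in M(a_1,a_2)$ with $L(m)s_1=s_2$ and $t_1=t_2R(m)$. The function $c\backslash\varepsilon/d\colon\mathrm{Ob}(c\backslash M/d)\to G$ is $(c\backslash\varepsilon/d)(s,a,t)=V(t)\varepsilon(a)H(s)$. Matrix of a $G$-span: $[M,\varepsilon]\colon\pi_0(S)\times\pi_0(T)\to\mathbf{Q}G$ is $$[M,\varepsilon](c,d)=\sum_{g\in G}\chi\big((c\backslash M/d)\{c\backslash\varepsilon/d=g\}\big)\,\chi(T\{d\})\,g.$$ Products are matrix products over $\mathbf{Q}G$, with rows and columns indexed by the sets $\pi_0$. *)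

(* Defs.v *)
From HB Require Import structures.
From mathcomp Require Import all_boot all_order all_algebra all_fingroup.

Set Implicit Arguments.
Unset Strict Implicit.
Unset Printing Implicit Defensive.

Import GRing.Theory.
Local Open Scope ring_scope.

(* The group ring R[gT] of a finite group: an element sum_g a_g g is stored as
   the function g |-> a_g. The type is an alias of {ffun gT -> R}, because the
   product is the convolution product and not the pointwise one. *)
Definition groupRing (R : nzRingType) (gT : finGroupType) : Type :=
  {ffun gT -> R}.

Section GroupRing.
Variables (R : nzRingType) (gT : finGroupType).
Local Notation RG := (groupRing R gT).

HB.instance Definition _ := GRing.Lmodule.copy RG {ffun gT -> R^o}.

Definition gr_of (g : gT) : RG := [ffun h => (h == g)%:R].

Definition gr_mul (x y : RG) : RG :=
  [ffun g => \sum_(h : gT) x h * y (h^-1 * g)%g].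

Lemma gr_mulA : associative gr_mul.
Proof.
move=> x y z; apply/ffunP=> g; rewrite !ffunE.
under eq_bigr => h _ do rewrite ffunE big_distrr /=.
under [RHS]eq_bigr => h _ do rewrite ffunE big_distrl /=.
rewrite [RHS]exchange_big /=; apply: eq_bigr => h _.
rewrite [RHS](reindex_inj (mulgI h)) /=; apply: eq_bigr => k _.
by rewrite mulrA mulKg invMg mulgA.
Qed.

Lemma gr_mul1x : left_id (gr_of 1) gr_mul.
Proof.
move=> x; apply/ffunP=> g; rewrite ffunE (bigD1 1%g) //= big1 ?addr0.
  by rewrite ffunE eqxx mul1r invg1 mul1g.
by move=> h /negPf h1; rewrite ffunE h1 mul0r.
Qed.

Lemma gr_mulx1 : right_id (gr_of 1) gr_mul.
Proof.
move=> x; apply/ffunP=> g; rewrite ffunE (bigD1 g) //= big1 ?addr0.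
  by rewrite ffunE mulVg eqxx mulr1.
by move=> h hg; rewrite ffunE -eq_mulVg1 (negPf hg) mulr0.
Qed.

Lemma gr_mulDl : left_distributive gr_mul +%R.
Proof.
move=> x y z; apply/ffunP=> g; rewrite !ffunE -big_split /=.
by apply: eq_bigr => h _; rewrite ffunE mulrDl.
Qed.

Lemma gr_mulDr : right_distributive gr_mul +%R.
Proof.
move=> x y z; apply/ffunP=> g; rewrite !ffunE -big_split /=.
by apply: eq_bigr => h _; rewrite ffunE mulrDr.
Qed.

Lemma gr_oner_neq0 : gr_of 1 != 0.
Proof.
by apply/eqP=> /ffunP/(_ 1%g)/eqP; rewrite !ffunE eqxx oner_eq0.
Qed.

HB.instance Definition _ := GRing.Zmodule_isNzRing.Build RG
  gr_mulA gr_mul1x gr_mulx1 gr_mulDl gr_mulDr gr_oner_neq0.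

End GroupRing.

(* compm g f is the composite "g after f". *)
Record finGroupoid := FinGroupoid {
  obj :> finType;
  hom : obj -> obj -> finType;
  idm : forall a, hom a a;
  compm : forall a b c, hom b c -> hom a b -> hom a c;
  invhom : forall a b, hom a b -> hom b a;
  compmA : forall a b c d (h : hom c d) (g : hom b c) (f : hom a b),
    compm h (compm g f) = compm (compm h g) f;
  comp1m : forall a b (f : hom a b), compm (idm b) f = f;
  compm1 : forall a b (f : hom a b), compm f (idm a) = f;
  compVm : forall a b (f : hom a b), compm (invhom f) f = idm a;
  compmV : forall a b (f : hom a b), compm f (invhom f) = idm b
}.

Arguments hom {S} a b : rename.
Arguments idm {S} a : rename.
Arguments compm {S a b c} g f : rename.
Arguments invhom {S a b} f : rename.

Record functor (S T : finGroupoid) := Functor {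
  fobj :> S -> T;
  fmap : forall a b : S, hom a b -> hom (fobj a) (fobj b);
  fmap_id : forall a, fmap (idm a) = idm (fobj a);
  fmap_comp : forall a b c (g : hom b c) (f : hom a b),
    fmap (compm g f) = compm (fmap g) (fmap f)
}.

Arguments fmap {S T} F {a b} f : rename.

Definition idF (S : finGroupoid) : functor S S :=
  @Functor S S id (fun _ _ f => f) (fun _ => erefl) (fun _ _ _ _ _ => erefl).

Definition BG (gT : finGroupType) : finGroupoid :=
  @FinGroupoid unit (fun _ _ => gT) (fun _ => 1%g)
    (fun _ _ _ g h => (g * h)%g) (fun _ _ g => (g^-1)%g)
    (fun _ _ _ _ => @mulgA gT) (fun _ _ => @mul1g gT)
    (fun _ _ => @mulg1 gT) (fun _ _ => @mulVg gT) (fun _ _ => @mulgV gT).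

(* The value of a functor H : S -> BG on a morphism, as an element of G. *)
Definition Bmap (gT : finGroupType) (S : finGroupoid) (H : functor S (BG gT))
  (a b : S) (f : hom a b) : gT := fmap H f.

Definition full_sub (S : finGroupoid) (P : pred S) : finGroupoid :=
  @FinGroupoid {a : S | P a} (fun a b => hom (val a) (val b))
    (fun a => idm (val a)) (fun _ _ _ g f => compm g f) (fun _ _ f => invhom f)
    (fun _ _ _ _ => @compmA S _ _ _ _) (fun _ _ => @comp1m S _ _)
    (fun _ _ => @compm1 S _ _) (fun _ _ => @compVm S _ _)
    (fun _ _ => @compmV S _ _).

Section EulerCharacteristic.
Variable S : finGroupoid.

(* In a groupoid every morphism is an isomorphism. *)
Definition iso_rel : rel S := fun a b => [exists f : hom a b, true].

Definition iso_classes : {set {set S}} :=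
  equivalence_partition iso_rel [set: S].

Definition pi0 : finType := {c : {set S} | c \in iso_classes}.

Definition choice_of_reps (r : pi0 -> S) : Prop :=
  forall c : pi0, r c \in val c.

Lemma iso_rel_equiv : {in [set: S] & &, equivalence_rel iso_rel}.
Proof.
move=> a b c _ _ _; split; first by apply/existsP; exists (idm _).
case/existsP=> f _; apply/existsP/existsP=> -[g _].
  by exists (compm g (invhom f)).
by exists (compm g f).
Qed.

Lemma pi0_inhabited (c : pi0) : exists a, a \in val c.
Proof.
apply/set0Pn; have /and3P[_ _ n0] := equivalence_partitionP iso_rel_equiv.
by apply: contraNneq n0 => <-; apply: (valP c).
Qed.

Definition pi0_repr (c : pi0) : S := xchoose (pi0_inhabited c).

Definition euler_char : rat :=
  \sum_(c : pi0) (#|hom (pi0_repr c) (pi0_repr c)|%:R)^-1.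

Lemma pi0_iso_rel (c : pi0) (a b : S) :
  a \in val c -> b \in val c -> iso_rel a b.
Proof.
case: c => c /= /imsetP[x _ ->]; rewrite !inE /= => xa xb.
by rewrite -(iso_rel_equiv (in_setT x) (in_setT a) (in_setT b)).2.
Qed.

Lemma iso_rel_card (a b : S) : iso_rel a b -> #|hom a a| = #|hom b b|.
Proof.
case/existsP=> f _; pose J (g : hom a a) := compm (compm f g) (invhom f).
pose K (g : hom b b) := compm (compm (invhom f) g) f.
have JK : cancel J K.
  move=> g; rewrite /J /K -!compmA compVm compm1.
  by rewrite compmA compVm comp1m.
have KJ : cancel K J.
  move=> g; rewrite /J /K -!compmA compmV compm1.
  by rewrite compmA compmV comp1m.
by apply: bij_eq_card; exists K; [exact: JK | exact: KJ].
Qed.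

(* The choice of representatives in euler_char is immaterial. *)
Lemma euler_charE (r : pi0 -> S) : choice_of_reps r ->
  euler_char = \sum_(c : pi0) (#|hom (r c) (r c)|%:R)^-1.
Proof.
move=> rP; apply: eq_bigr => c _; congr (_%:R^-1); apply: iso_rel_card.
exact: (pi0_iso_rel (xchooseP (pi0_inhabited c)) (rP c)).
Qed.

End EulerCharacteristic.

Record Gspan (gT : finGroupType) (S T : finGroupoid)
    (H : functor S (BG gT)) (V : functor T (BG gT)) := GSpan {
  apex : finGroupoid;
  legL : functor apex S;
  legR : functor apex T;
  eps : apex -> gT;
  eps_nat : forall (a1 a2 : apex) (m : hom a1 a2),
    (eps a2 * Bmap H (fmap legL m) = Bmap V (fmap legR m) * eps a1)%g
}.

Section IdentitySpan.
Variables (gT : finGroupType) (S : finGroupoid) (H : functor S (BG gT)).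

Lemma id_span_nat (a1 a2 : S) (m : hom a1 a2) :
  (1 * Bmap H (fmap (idF S) m) = Bmap H (fmap (idF S) m) * 1)%g.
Proof. by rewrite mul1g mulg1. Qed.

Definition id_span : Gspan H H :=
  @GSpan gT S S H H S (idF S) (idF S) (fun _ => 1%g) id_span_nat.

End IdentitySpan.

Section HomotopyFibre.
Variables (S T M : finGroupoid) (L : functor M S) (R : functor M T).
Variables (c : S) (d : T).

(* The triple (s, a, t) is encoded as the dependent pair of a and (s, t). *)
Definition hfib_obj : finType :=
  {a : M & (hom c (L a) * hom (R a) d)%type}.

Definition hfib_pt (x : hfib_obj) : M := tag x.
Definition hfib_s (x : hfib_obj) : hom c (L (hfib_pt x)) := (tagged x).1.
Definition hfib_t (x : hfib_obj) : hom (R (hfib_pt x)) d := (tagged x).2.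

Definition hfib_homb (x y : hfib_obj) : pred (hom (hfib_pt x) (hfib_pt y)) :=
  fun m => (compm (fmap L m) (hfib_s x) == hfib_s y)
        && (hfib_t x == compm (hfib_t y) (fmap R m)).

Definition hfib_hom (x y : hfib_obj) : finType :=
  {m : hom (hfib_pt x) (hfib_pt y) | hfib_homb m}.

Lemma hfib_id_proof x : @hfib_homb x x (idm _).
Proof. by rewrite /hfib_homb !fmap_id comp1m compm1 !eqxx. Qed.

Lemma hfib_comp_proof x y z (n : hfib_hom y z) (m : hfib_hom x y) :
  @hfib_homb x z (compm (val n) (val m)).
Proof.
case: n m => [n /= /andP[/eqP n1 /eqP n2]] [m /= /andP[/eqP m1 /eqP m2]].
by rewrite /hfib_homb !fmap_comp -compmA m1 n1 compmA -n2 m2 !eqxx.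
Qed.

Lemma hfib_inv_proof x y (m : hfib_hom x y) : @hfib_homb y x (invhom (val m)).
Proof.
case: m => [m /= /andP[/eqP m1 /eqP m2]].
rewrite /hfib_homb -m1 m2 compmA -fmap_comp compVm fmap_id comp1m.
by rewrite -compmA -fmap_comp compmV fmap_id compm1 !eqxx.
Qed.

Definition hfib_idm x : hfib_hom x x :=
  exist (fun m => hfib_homb m) (idm _) (hfib_id_proof x).
Definition hfib_comp x y z (n : hfib_hom y z) (m : hfib_hom x y) :
  hfib_hom x z := exist (fun m => hfib_homb m) _ (hfib_comp_proof n m).
Definition hfib_inv x y (m : hfib_hom x y) : hfib_hom y x :=
  exist (fun m => hfib_homb m) _ (hfib_inv_proof m).

Lemma hfib_compA x y z w (h : hfib_hom z w) (g : hfib_hom y z)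
  (f : hfib_hom x y) :
  hfib_comp h (hfib_comp g f) = hfib_comp (hfib_comp h g) f.
Proof. by apply: val_inj; apply: compmA. Qed.

Lemma hfib_comp1m x y (f : hfib_hom x y) : hfib_comp (hfib_idm y) f = f.
Proof. by apply: val_inj; apply: comp1m. Qed.

Lemma hfib_compm1 x y (f : hfib_hom x y) : hfib_comp f (hfib_idm x) = f.
Proof. by apply: val_inj; apply: compm1. Qed.

Lemma hfib_compVm x y (f : hfib_hom x y) :
  hfib_comp (hfib_inv f) f = hfib_idm x.
Proof. by apply: val_inj; apply: compVm. Qed.

Lemma hfib_compmV x y (f : hfib_hom x y) :
  hfib_comp f (hfib_inv f) = hfib_idm y.
Proof. by apply: val_inj; apply: compmV. Qed.

Definition hfib : finGroupoid :=
  FinGroupoid hfib_compA hfib_comp1m hfib_compm1 hfib_compVm hfib_compmV.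

End HomotopyFibre.

Section SpanMatrix.
Variables (gT : finGroupType) (S T : finGroupoid).
Variables (H : functor S (BG gT)) (V : functor T (BG gT)).

Definition span_fib (M : Gspan H V) (c : S) (d : T) : finGroupoid :=
  hfib (legL M) (legR M) c d.

Definition fib_eps (M : Gspan H V) (c : S) (d : T) (x : span_fib M c d) : gT :=
  (Bmap V (hfib_t x) * eps (hfib_pt x) * Bmap H (hfib_s x))%g.

Definition span_entry (M : Gspan H V) (c : S) (d : T) : groupRing rat gT :=
  \sum_(g : gT)
    (euler_char (full_sub [pred x : span_fib M c d | fib_eps x == g])
     * euler_char (full_sub (pred1 d))) *: gr_of rat g.

(* Rows and columns are indexed by pi0 S and pi0 T through their canonical
   enumerations; rS and rT give the representative of each class. *)
Definition span_mx (rS : pi0 S -> S) (rT : pi0 T -> T) (M : Gspan H V) :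
    'M[groupRing rat gT]_(#|pi0 S|, #|pi0 T|) :=
  \matrix_(i, j) span_entry M (rS (enum_val i)) (rT (enum_val j)).

End SpanMatrix.

(* Main.v *)
(* Weight an object by the inverse of the number of arrows leaving it. The Euler
   characteristic is the total weight, and an object (s, a, t) of a homotopy
   fibre has the weight of a, so
     [M, eps](c, d) = 1/|T(d, d)| sum_(s, a, t) weight(a) V(t) eps(a) H(s).
   For the identity span, substituting u = t s gives
     [id](c, c') = 1/|S(c', c')| sum_(u in S(c, c')) H(u),
   so the matrix is diagonal. Since G is abelian, multiplying [M, eps](c, d) by
   H(u) amounts to permuting the fibre by s |-> s u, hence fixes the entry. The
   right-hand side is symmetric, with t |-> u t. *)
Require Import Defs.
From mathcomp Require Import all_boot all_order all_algebra all_fingroup.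

Set Implicit Arguments.
Unset Strict Implicit.
Unset Printing Implicit Defensive.

Import GRing.Theory Num.Theory.
Import Defs.

Local Open Scope ring_scope.

Section GroupRingTheory.
Variables (R : comNzRingType) (gT : finGroupType).
Implicit Types (k : R) (x y : groupRing R gT) (g h : gT).

Lemma gr_ofM g h : gr_of R g * gr_of R h = gr_of R (g * h)%g.
Proof.
apply/ffunP=> u; rewrite !ffunE (bigD1 g) //= !ffunE eqxx mul1r big1 ?addr0.
  by rewrite (can2_eq (mulKVg g) (mulKg g)).
by move=> v /negPf vg; rewrite ffunE vg mul0r.
Qed.

Lemma gr_scalerAl k x y : k *: (x * y) = (k *: x) * y.
Proof.
apply/ffunP=> u; rewrite !ffunE scaler_sumr; apply: eq_bigr => v _.
by rewrite ffunE; apply: mulrA.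
Qed.

Lemma gr_scalerAr k x y : k *: (x * y) = x * (k *: y).
Proof.
apply/ffunP=> u; rewrite !ffunE scaler_sumr; apply: eq_bigr => v _.
by rewrite ffunE; apply: mulrCA.
Qed.

End GroupRingTheory.

Section Groupoids.
Variable S : finGroupoid.
Implicit Types a b c : S.

Lemma precomp_bij a b c (f : hom a b) :
  bijective (fun g : hom b c => compm g f).
Proof.
exists (fun g => compm g (invhom f)) => g.
  by rewrite -compmA compmV compm1.
by rewrite -compmA compVm compm1.
Qed.

Lemma postcomp_bij a b c (f : hom b c) :
  bijective (fun g : hom a b => compm f g).
Proof.
exists (fun g => compm (invhom f) g) => g.
  by rewrite compmA compVm comp1m.
by rewrite compmA compmV comp1m.
Qed.

Definition outdeg a := (\sum_b #|hom a b|)%N.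

Lemma outdeg_iso a b : hom a b -> outdeg a = outdeg b.
Proof.
move=> f; apply: eq_bigr => c _; apply/esym/bij_eq_card.
exact: (precomp_bij c f).
Qed.

Lemma card_endo_gt0 a : (0 < #|hom a a|)%N.
Proof. by apply/card_gt0P; exists (idm a). Qed.

Lemma outdeg_gt0 a : (0 < outdeg a)%N.
Proof. by rewrite /outdeg (bigD1 a) //= addn_gt0 card_endo_gt0. Qed.

(** [outdeg] is constant along arrows, so each of the [outdeg a] arrows out of [a] contributes
    [1 / outdeg a]. This collapses the sum over apex objects in [id_span_entryE]. *)
Lemma sum_outdeg_inv a : \sum_b \sum_(f : hom a b) (outdeg b)%:R^-1 = 1 :> rat.
Proof.
transitivity (\sum_b \sum_(f : hom a b) (outdeg a)%:R^-1 : rat).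
  by apply: eq_bigr => b _; apply: eq_bigr => f _; rewrite (outdeg_iso f).
under eq_bigr => b _ do rewrite sumr_const -[_ *+ #|_|]mulr_natr.
by rewrite -mulr_sumr -natr_sum mulVf // pnatr_eq0 -lt0n outdeg_gt0.
Qed.

Lemma mem_pi0 (c : pi0 S) a b : a \in val c -> (b \in val c) = iso_rel a b.
Proof.
move=> ac; apply/idP/idP=> [|ab]; first exact: pi0_iso_rel ac.
case: c ac => c /= /imsetP[x _ ->]; rewrite !inE /= => xa.
by rewrite (iso_rel_equiv (in_setT x) (in_setT a) (in_setT b)).2.
Qed.

(** Composing with an arrow [a -> b] identifies [hom a a] with [hom a b] for each [b] in the class,
    and no arrow leaves the class. *)
Lemma outdeg_pi0 (c : pi0 S) a : a \in val c ->
  outdeg a = (#|val c| * #|hom a a|)%N.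
Proof.
move=> ac; rewrite /outdeg (bigID [in val c]) /= [X in (_ + X)%N]big1 ?addn0.
  rewrite -sum_nat_const; apply: eq_bigr => b; rewrite (mem_pi0 _ ac).
  by case/existsP=> f _; apply/esym/bij_eq_card; apply: (postcomp_bij a f).
move=> b; rewrite (mem_pi0 _ ac) => /existsP nf; apply/eqP.
by rewrite -leqn0 leqNgt; apply/card_gt0P=> -[f _]; case: nf; exists f.
Qed.

(* Weighting each object by the number of arrows leaving it replaces the choice
   of representatives: the weights of a class sum to 1 / |S(c, c)|. *)
Lemma euler_char_outdeg : euler_char S = \sum_a (outdeg a)%:R^-1.
Proof.
have part := equivalence_partitionP (@iso_rel_equiv S).
rewrite -[RHS](eq_bigl _ _ (@in_setT S)) (set_partition_big _ part) /=.
rewrite big_sub /=; apply: eq_bigr => c _.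
have rc := xchooseP (pi0_inhabited c); rewrite -/(pi0_repr c) in rc.
transitivity (\sum_(a in val c) (outdeg (pi0_repr c))%:R^-1 : rat).
  rewrite sumr_const (outdeg_pi0 rc) natrM invfM -[RHS]mulr_natl mulrA divff ?mul1r //.
  by rewrite pnatr_eq0 -lt0n; apply/card_gt0P; exists (pi0_repr c).
apply: eq_bigr => a; rewrite (mem_pi0 _ rc) => /existsP[f _].
by rewrite (outdeg_iso f).
Qed.

End Groupoids.

Lemma euler_char_pred1 (S : finGroupoid) (d : S) :
  euler_char (full_sub (pred1 d)) = #|hom d d|%:R^-1.
Proof.
rewrite euler_char_outdeg.
transitivity (\sum_(a in pred1 d) (\sum_(b in pred1 d) #|hom a b|)%N%:R^-1 : rat).
  by rewrite [RHS]big_sub; apply: eq_bigr => a _; rewrite [in RHS]big_sub.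
by rewrite !big_pred1_eq.
Qed.

Section Fibre.
Variables (S T M : finGroupoid) (L : functor M S) (R : functor M T).
Variables (c : S) (d : T).
Implicit Type x : hfib L R c d.

(* A morphism out of (s, a, t) is a morphism out of a: its target is forced. *)
Lemma hfib_outdeg x : outdeg x = outdeg (hfib_pt x).
Proof.
pose F (b : M) (st : hom c (L b) * hom (R b) d) : hfib L R c d :=
  Tagged (fun b => (hom c (L b) * hom (R b) d)%type) st.
transitivity (\sum_b \sum_st \sum_(m : hom (hfib_pt x) b)
   (@hfib_homb _ _ _ L R c d x (F b st) m))%N.
  rewrite sig_big_dep /=; apply: eq_bigr => -[b st] _ /=.
  by rewrite card_sig -sum1_card big_mkcond.
apply: eq_bigr => b _; rewrite exchange_big /= -sum1_card; apply: eq_bigr => m _.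
(* Solving [L(m) s = s'] and [t = t' R(m)] for [(s', t')] gives the only endpoint over [b] that [m]
   can have. *)
pose st0 := (compm (fmap L m) (hfib_s x), compm (hfib_t x) (invhom (fmap R m))).
rewrite (bigD1 st0) //= big1 => [|[s t]].
  by rewrite /hfib_homb /= -compmA compVm compm1 !eqxx.
apply: contraNeq; rewrite eqb0 negbK => /andP[/eqP sE /eqP tE].
rewrite /hfib_s /hfib_t /= in sE tE.
by rewrite /st0 /hfib_s /hfib_t sE tE -compmA compmV compm1.
Qed.

(** As [P] is closed under arrows, the full subgroupoid keeps every arrow out of its objects, and
    their weights are unchanged. *)
Lemma full_sub_hfib_euler_char (P : pred (hfib L R c d)) :
  (forall x y, hom x y -> P x -> P y) ->
  euler_char (full_sub P) = \sum_(x | P x) (outdeg (hfib_pt x))%:R^-1.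
Proof.
move=> Pmor; rewrite euler_char_outdeg [RHS]big_sub; apply: eq_bigr => -[x Px] _ /=.
rewrite -hfib_outdeg /outdeg; congr (_%:R^-1).
rewrite -[LHS](big_sub _ (fun y => #|hom x y|)) [RHS](bigID P) /=.
rewrite [X in (_ + X)%N]big1 ?addn0 // => y; apply: contraNeq.
by rewrite -lt0n => /card_gt0P[m _]; apply: Pmor Px.
Qed.

End Fibre.

Lemma Bmap_comp (gT : finGroupType) (S : finGroupoid) (H : functor S (BG gT))
  (a b c : S) (g : hom b c) (f : hom a b) :
  Bmap H (compm g f) = (Bmap H g * Bmap H f)%g.
Proof. exact: (fmap_comp H g f). Qed.

Section SpanEntries.
Variables (gT : finGroupType) (S T : finGroupoid).
Variables (H : functor S (BG gT)) (V : functor T (BG gT)) (M : Gspan H V).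

(** Naturality of [eps] carries [m] from one leg to the other. Hence the level sets of [fib_eps] are
    closed under arrows, as [full_sub_hfib_euler_char] requires. *)
Lemma fib_eps_hom (c : S) (d : T) (x y : span_fib M c d) :
  hom x y -> fib_eps x = fib_eps y.
Proof.
case: x y => [a [s t]] [b [s' t']] [m /= /andP[/eqP sE /eqP tE]].
rewrite /fib_eps -sE tE /= !Bmap_comp.
by rewrite -!mulgA [in RHS](mulgA (eps b)) eps_nat !mulgA.
Qed.

Lemma span_entryE (c : S) (d : T) :
  span_entry M c d = #|hom d d|%:R^-1 *:
    \sum_(x : span_fib M c d) (outdeg (hfib_pt x))%:R^-1 *: gr_of rat (fib_eps x).
Proof.
rewrite (partition_big (@fib_eps _ _ _ _ _ M c d) xpredT) //= scaler_sumr.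
apply: eq_bigr => g _; rewrite euler_char_pred1 mulrC -scalerA; congr (_ *: _).
rewrite full_sub_hfib_euler_char => [|x y m /=]; last by rewrite (fib_eps_hom m).
by rewrite scaler_suml; apply: eq_bigr => x /eqP <-.
Qed.

Hypothesis abelG : abelian [set: gT].

Lemma abelianT_mulgC (g h : gT) : (g * h = h * g)%g.
Proof. by apply: (centsP abelG); rewrite inE. Qed.

Lemma gr_of_mul_span_entry (c c' : S) (d : T) (u : hom c c') :
  gr_of rat (Bmap H u) * span_entry M c' d = span_entry M c d.
Proof.
rewrite !span_entryE -gr_scalerAr; congr (_ *: _); rewrite mulr_sumr.
(* Precomposition with [u] maps the fibre at [c'] to the fibre at [c], with inverse given by
   [invhom u]. It puts [H(u)] at the right end of [fib_eps]; commutativity brings it to the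
   front. *)
pose h c1 c2 (v : hom c1 c2) (x : span_fib M c2 d) : span_fib M c1 d :=
  Tagged (fun a => (hom c1 (legL M a) * hom (legR M a) d)%type)
    (compm (hfib_s x) v, hfib_t x).
rewrite [RHS](reindex (h c c' u)) /=.
  apply: eq_bigr => x _; rewrite -gr_scalerAr gr_ofM; congr (_ *: gr_of _ _).
  by rewrite /fib_eps /= Bmap_comp [LHS]abelianT_mulgC !mulgA.
apply: onW_bij; exists (h c' c (invhom u)) => -[a [s t]]; rewrite /h /hfib_s /=.
  by rewrite -compmA compmV compm1.
by rewrite -compmA compVm compm1.
Qed.

Lemma span_entry_mul_gr_of (c : S) (d d' : T) (u : hom d d') :
  span_entry M c d * gr_of rat (Bmap V u) = span_entry M c d'.
Proof.
(* The prefactor depends on the target object, but isomorphic objects have equally many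
   automorphisms. *)
have dd' : iso_rel d d' by apply/existsP; exists u.
rewrite !span_entryE (iso_rel_card dd') -gr_scalerAl.
congr (_ *: _); rewrite mulr_suml.
pose h d1 d2 (v : hom d1 d2) (x : span_fib M c d1) : span_fib M c d2 :=
  Tagged (fun a => (hom c (legL M a) * hom (legR M a) d2)%type)
    (hfib_s x, compm v (hfib_t x)).
rewrite [RHS](reindex (h d d' u)) /=.
  apply: eq_bigr => x _; rewrite -gr_scalerAl gr_ofM; congr (_ *: gr_of _ _).
  by rewrite /fib_eps /= Bmap_comp [LHS]abelianT_mulgC !mulgA.
apply: onW_bij; exists (h d' d (invhom u)) => -[a [s t]]; rewrite /h /hfib_t /=.
  by rewrite compmA compVm comp1m.
by rewrite compmA compmV comp1m.
Qed.

End SpanEntries.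

Section IdentityEntries.
Variables (gT : finGroupType) (S : finGroupoid) (H : functor S (BG gT)).

Lemma id_span_entryE (c c' : S) :
  span_entry (id_span H) c c' =
    #|hom c' c'|%:R^-1 *: \sum_(u : hom c c') gr_of rat (Bmap H u).
Proof.
rewrite span_entryE; congr (_ *: _).
transitivity (\sum_a \sum_(st : hom c a * hom a c')
   (outdeg a)%:R^-1 *: gr_of rat (Bmap H (compm st.2 st.1))).
  rewrite sig_big_dep; apply: eq_bigr => -[a [s t]] _.
  by rewrite /fib_eps /= mulg1 Bmap_comp.
(* The factor 1 is expanded as the weighted sum over all arrows [s] out of [c], to be matched term
   by term. *)
rewrite -[RHS]scale1r -[in RHS](sum_outdeg_inv c) scaler_suml; apply: eq_bigr => a _.
transitivity (\sum_(s : hom c a) \sum_(t : hom a c')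
   (outdeg a)%:R^-1 *: gr_of rat (Bmap H (compm t s))); first by rewrite pair_bigA.
rewrite scaler_suml; apply: eq_bigr => s _; rewrite -scaler_sumr.
(* For fixed [s], the substitution [u = t s] is a bijection, so the inner sum does not depend on
   [s]. *)
by rewrite [in RHS](reindex _ (onW_bij _ (precomp_bij c' s))).
Qed.

(** A nonzero entry needs an arrow between the representatives, which puts [r j] in both classes;
    distinct classes are disjoint. *)
Lemma id_span_entry_neq0 (r : pi0 S -> S) (i j : pi0 S) :
  choice_of_reps r -> span_entry (id_span H) (r i) (r j) != 0 -> i = j.
Proof.
move=> hr; rewrite id_span_entryE; case: (pickP (@predT (hom (r i) (r j)))).
  move=> f _ _; have ij : r j \in val i.
    by rewrite (mem_pi0 _ (hr i)); apply/existsP; exists f.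
  have /and3P[_ tr _] := equivalence_partitionP (@iso_rel_equiv S).
  apply: val_inj.
  by rewrite -(def_pblock tr (valP i) ij) (def_pblock tr (valP j) (hr j)).
by move=> no; rewrite big_pred0 ?scaler0 ?eqxx.
Qed.

End IdentityEntries.

Theorem proposition4p9 (gT : finGroupType) (abelG : abelian [set: gT])
  (S T : finGroupoid) (H : functor S (BG gT)) (V : functor T (BG gT))
  (M : Gspan H V)
  (rS : pi0 S -> S) (rT : pi0 T -> T)
  (hrS : choice_of_reps rS) (hrT : choice_of_reps rT) :
  span_mx rS rS (id_span H) *m span_mx rS rT M = span_mx rS rT M
  /\ span_mx rS rT M = span_mx rS rT M *m span_mx rT rT (id_span V).
Proof.
(* Once each [H(u)] or [V(u)] is absorbed, the diagonal term is an average of equal entries over an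
   automorphism group. *)
have cardK (U : finGroupoid) (a : U) (x : groupRing rat gT) :
  #|hom a a|%:R^-1 *: \sum_(u : hom a a) x = x.
  rewrite sumr_const -scaler_nat scalerA mulVf ?scale1r //.
  by rewrite pnatr_eq0 -lt0n card_endo_gt0.
split; apply/matrixP=> i j; rewrite !mxE.
  rewrite (bigD1 i) //= big1 => [|k ki].
    rewrite addr0 !mxE id_span_entryE -gr_scalerAl mulr_suml.
    under eq_bigr => u _ do rewrite gr_of_mul_span_entry //.
    exact: cardK.
  rewrite !mxE; apply/eqP; apply: contraNT ki => nz.
  apply/eqP/esym/enum_val_inj/(id_span_entry_neq0 (H := H) hrS).
  by apply: contraNneq nz => ->; rewrite mul0r.
rewrite (bigD1 j) //= big1 => [|k kj].
  rewrite addr0 !mxE id_span_entryE -gr_scalerAr mulr_sumr.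
  under eq_bigr => u _ do rewrite span_entry_mul_gr_of //.
  by rewrite cardK.
rewrite !mxE; apply/eqP; apply: contraNT kj => nz.
apply/eqP/enum_val_inj/(id_span_entry_neq0 (H := V) hrT).
by apply: contraNneq nz => ->; rewrite mulr0.
Qed.
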